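(* Let $X$ be a $T_1$ strongly star-Rothberger space with countable extent. Then its Alexandroff duplicate $A(X)$ is strongly star-Rothberger.
   Context: The extent of $X$ is $e(X)=\sup\{|Y| : Y \text{ is a closed and discrete subspace of } X\}$; $X$ has countable extent if $e(X)\leq\omega$, i.e. every closed discrete subspace is countable. The Alexandroff duplicate of $X$ is $A(X)=X\times\{0,1\}$, where each point of $X\times\{1\}$ is isolated and a basic neighbourhood of $\langle x,0\rangle$ is a set of the form $(U\times\{0\})\cup((U\times\{1\})\setminus\{\langle x,1\rangle\})$ with $U$ a neighbourhood of $x$ in $X$. For a point $x$ of a space $Z$ and a collection $\mathcal{P}$ of subsets of $Z$, $St(x,\mathcal{P})=\bigcup\{B\in\mathcal{P} : x\in B\}$. $Z$ is strongly star-Rothberger if for each sequence $(\mathcal{U}_n)_{n\in\mathbb{N}}$ of open covers of $Z$ there are points $x_n\in Z$ such that $\{St(x_n,\mathcal{U}_n) : n\in\mathbb{N}\}$ covers $Z$. *)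

(* Defs.v *)
From HB Require Import structures.
From mathcomp Require Import all_boot all_order all_algebra.
From mathcomp Require Import all_classical all_reals all_analysis.

Set Implicit Arguments.
Unset Strict Implicit.
Unset Printing Implicit Defensive.

Local Open Scope classical_set_scope.

(* A set [Y] used as a type carries the subspace topology; the equation is the
   library's definition of a discrete topology ([nbhs_principalE]). *)
Definition discrete_subspace (X : topologicalType) (Y : set X) : Prop :=
  @nbhs Y Y = principal_filter.

Definition countable_extent (X : topologicalType) : Prop :=
  forall Y : set X, closed Y -> discrete_subspace Y -> countable Y.

Definition open_cover (Z : topologicalType) (P : set (set Z)) : Prop :=
  P `<=` open /\ cover P id = [set: Z].

Definition St (Z : Type) (x : Z) (P : set (set Z)) : set Z :=
  \bigcup_(B in [set B | P B /\ B x]) B.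

Definition strongly_star_Rothberger (Z : topologicalType) : Prop :=
  forall U : nat -> set (set Z), (forall n, open_cover (U n)) ->
    exists x : nat -> Z, cover [set: nat] (fun n => St (x n) (U n)) = [set: Z].

(* [(x, false)] is the point <x,0> and [(x, true)] is the point <x,1>.
   This is an alias, so as not to inherit the product topology: the points and
   sets must be typed in [alexandroff_duplicate X], not in [X * bool]. *)
Definition alexandroff_duplicate (X : Type) : Type := (X * bool)%type.

Section alexandroff_duplicate.
Context {X : topologicalType}.
Local Notation AX := (alexandroff_duplicate X).

HB.instance Definition _ := Choice.copy AX (X * bool)%type.

Definition duplicate_basic (x : X) (U : set X) : set AX :=
  (U `*` [set false]) `|` ((U `*` [set true]) `\` [set (x, true)]).

(* The open sets are those containing a basic neighbourhood of each of their
   points; the basic neighbourhood [set (x, true)] of (x, true) imposes no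
   condition. When [X] is not T1, a [duplicate_basic x U] need not be a
   neighbourhood of (x, false), even for open [U]; when [X] is T1, these sets
   do form a neighbourhood base (see [duplicate_nbhs_false]). *)
Definition duplicate_open : set_system AX :=
  [set O | forall x : X, O (x, false) ->
     exists2 U, nbhs x U & duplicate_basic x U `<=` O].

Let duplicate_openT : duplicate_open [set: AX].
Proof. by move=> x _; exists [set: X] => //; exact: filterT. Qed.

Let duplicate_openI : setI_closed duplicate_open.
Proof.
move=> A B oA oB x [/oA[U xU UA] /oB[V xV VB]].
exists (U `&` V); first exact: filterI.
move=> z Hz; split; [apply: UA | apply: VB]; move: Hz.
- by case=> [[[? ?] ?]|[[[? ?] ?] ?]]; [left|right].
- by case=> [[[? ?] ?]|[[[? ?] ?] ?]]; [left|right].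
Qed.

Let duplicate_open_bigU (I : Type) (f : I -> set AX) :
  (forall i, duplicate_open (f i)) -> duplicate_open (\bigcup_i f i).
Proof.
move=> of_ x [i _ /of_[U xU Uf]]; exists U => // z /Uf fz.
by exists i.
Qed.

HB.instance Definition _ := isOpenTopological.Build AX
  duplicate_openT duplicate_openI duplicate_open_bigU.

Lemma duplicate_openE (O : set AX) : open O <-> duplicate_open O.
Proof.
rewrite openE; split=> [oO x Ox|oO p Op]; last by exists O; split.
have [B [oB Bx BO]] := oO _ Ox.
have [U xU UB] := oB _ Bx.
by exists U => //; exact: subset_trans BO.
Qed.

Lemma duplicate_nbhs_true (x : X) :
  @nbhs _ AX (x, true) = principal_filter ((x, true) : AX).
Proof.
rewrite predeqE => A; split=> [/nbhs_singleton Ax|/principal_filterP Ax].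
  exact/principal_filterP.
by exists [set (x, true) : AX]; split=> [y|//|_ ->].
Qed.

Lemma duplicate_nbhs_false (x : X) : accessible_space X ->
  @nbhs _ AX (x, false) = filter_from (nbhs x) (duplicate_basic x).
Proof.
move=> T1; rewrite predeqE => A; split=> [[B [oB Bx BA]]|[U xU UA]].
  by have [U xU UB] := oB _ Bx; exists U => //; exact: subset_trans BA.
exists (duplicate_basic x U°); split; last first.
- move=> z Hz; apply: UA; case: Hz.
  + by move=> [/interior_subset ? ?]; left.
  + by move=> [[/interior_subset ? ?] ?]; right.
- by left; split.
move=> y [[Uy _]|[[_ //]]].
have [<-|/eqP yx] := pselect (y = x).
  by exists U°; [exact: nbhs_interior|].
have [V [oV /set_mem Vy /set_mem Vx]] := T1 _ _ yx.
exists (U° `&` V).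
  by apply: filterI; [exact: nbhs_interior | exact: open_nbhs_nbhs].
case=> z b [[[Uz _] bF]|[[[Uz Vz] bT] _]]; [by left|right; split => //].
by case=> zx _; apply: Vx; rewrite -zx.
Qed.

End alexandroff_duplicate.

(* Main.v *)
Require Import Defs.
From mathcomp Require Import all_boot all_order all_algebra.
From mathcomp Require Import all_classical all_reals all_analysis.

(** Apply the property of X, at the even indices, to the traces on X x {0} of
    the given covers. The corresponding stars in A(X) have a union O that is open
    and contains X x {0}. Any x then has a neighbourhood W with
    W x {1} contained in O except perhaps for <x,1>, so the points y with <y,1>
    outside O form a closed discrete subset of X. This set is countable, and
    the odd indices suffice to pick its points one by one. *)

Local Open Scope classical_set_scope.

(** The neighbourhood [W] of a point [x] of the closure meets [Y], and can do so only at [x]. *)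
Lemma locally_subsingleton_closed (X : topologicalType) (Y : set X) :
  (forall x, exists2 W, nbhs x W & W `&` Y `<=` [set x]) -> closed Y.
Proof.
move=> locY x clYx; have [W xW WY] := locY x.
by have [y [Yy Wy]] := clYx _ xW; rewrite -(WY y (conj Wy Yy)).
Qed.

Lemma locally_subsingleton_discrete (X : topologicalType) (Y : set X) :
  (forall x, exists2 W, nbhs x W & W `&` Y `<=` [set x]) ->
  discrete_subspace Y.
Proof.
move=> locY; apply/funext => y; rewrite predeqE => A.
split=> [/nbhs_singleton Ay|/principal_filterP Ay]; first exact/principal_filterP.
have [W yW WY] := locY (set_val y).
(* The inclusion of [Y] is continuous, so the trace of [W] is a neighbourhood of [y] in [Y]; it
   reduces to [y]. *)
have : nbhs y (set_val @^-1` W) by exact: (@initial_continuous Y X set_val).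
apply: filterS => z Wz; suff -> : z = y by [].
by apply: val_inj; apply: WY; split=> //; exact: set_valP.
Qed.

(** A basic neighbourhood loses a point only in the upper copy, so its trace on the lower copy is
    all of [U]. *)
Lemma continuous_duplicate_false (X : topologicalType) :
  continuous (fun x : X => (x, false) : alexandroff_duplicate X).
Proof.
apply/continuousP => O /duplicate_openE oO.
rewrite openE => x /oO[U xU UO].
by apply: filterS xU => y Uy; apply: UO; left.
Qed.

Lemma duplicate_uncovered_locally_subsingleton (X : topologicalType)
    (O : set (alexandroff_duplicate X)) :
  open O -> (forall x : X, O (x, false)) ->
  forall x, exists2 W, nbhs x W & W `&` [set y | ~ O (y, true)] `<=` [set x].
Proof.
move=> /duplicate_openE oO Ofalse x; have [W xW WO] := oO x (Ofalse x).
exists W => // y [Wy /= nOy]; apply: contrapT => yx; apply: nOy.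
by apply: WO; right; split=> // -[].
Qed.

Lemma open_St (Z : topologicalType) (x : Z) (P : set (set Z)) :
  P `<=` open -> open (St x P).
Proof. by move=> oP; apply: bigcup_open => B [/oP]. Qed.

Lemma St_refl (Z : topologicalType) (x : Z) (P : set (set Z)) :
  open_cover P -> St x P x.
Proof.
move=> [_ cP]; have [B PB Bx] : cover P id x by rewrite cP.
by exists B.
Qed.

Lemma open_cover_preimage (X Z : topologicalType) (f : X -> Z)
    (P : set (set Z)) :
  continuous f -> open_cover P -> open_cover ((fun B => f @^-1` B) @` P).
Proof.
move=> /continuousP cf [oP cP]; split=> [_ [B PB <-]|]; first exact/cf/oP.
rewrite -subTset => x _; have [B PB Bx] : cover P id (f x) by rewrite cP.
by exists (f @^-1` B) => //; exists B.
Qed.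

(** This turns stars for the trace covers on [X] into traces of stars in the duplicate, centred at
    lower points. *)
Lemma St_preimage (X Z : Type) (f : X -> Z) (P : set (set Z)) (x : X) :
  St x ((fun B => f @^-1` B) @` P) = f @^-1` St (f x) P.
Proof.
apply/seteqP; split=> y; first by move=> [_ [[B PB <-] Bx] By]; exists B.
by move=> [B [PB Bx] By]; exists (f @^-1` B) => //; split=> //; exists B.
Qed.

Theorem theorem4p25 (X : topologicalType) :
  accessible_space X ->
  strongly_star_Rothberger X ->
  countable_extent X ->
  strongly_star_Rothberger (alexandroff_duplicate X).
Proof.
move=> _ ssrX ceX U ocU.
pose AX := alexandroff_duplicate X.
pose i0 (x : X) : AX := (x, false).
have [x cx] := ssrX _ (fun n =>
  open_cover_preimage _ _ _ _ (continuous_duplicate_false X) (ocU n.*2)).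
pose O : set AX := \bigcup_n St (i0 (x n)) (U n.*2).
have oO : open O by apply: bigcup_open => n _; apply: open_St; case: (ocU n.*2).
have Ofalse y : O (i0 y).
  have : [set: X] y by [].
  rewrite -cx => -[n _].
  by rewrite (St_preimage X AX i0); exists n.
have locY := duplicate_uncovered_locally_subsingleton _ _ oO Ofalse.
pose Y := [set y | ~ O (y, true)].
have /countable_injP[f finj] : countable Y.
  apply: ceX; first exact: locally_subsingleton_closed.
  exact: locally_subsingleton_discrete.
(* [g] inverts [f] on [Y], by injectivity; where [k] is not a value of [f] on [Y], any point will
   do, and [x k] is at hand. *)
have /choice[g gP] : forall k, exists z : X, forall y, Y y -> f y = k -> z = y.
  move=> k; have [[y [Yy <-]]|nY] := pselect (exists y, Y y /\ f y = k).
    by exists y => z Yz fzy; apply: finj; rewrite ?inE.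
  by exists (x k) => y Yy fy; case: nY; exists y.
exists (fun n => if odd n then (g n./2, true) else i0 (x n./2)).
rewrite -subTset => p _; have [[n _ Op]|nOp] := pselect (O p).
  by exists n.*2 => //=; rewrite odd_double doubleK.
case: p nOp => y [] nOp; last by case: nOp; exact: Ofalse.
(* Halving this odd index gives [f y], and [g] sends it back to [y], so the star is centred at
   [(y, true)] itself. *)
exists (f y).*2.+1 => //=.
by rewrite odd_double /= uphalf_double (gP _ _ nOp erefl); exact: St_refl.
Qed.
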